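(* Let $(x,y)\in R_- := \{(x,y)\in\mathbb{R}^2 \mid 0<-x<y,\ 0<y<1\}$ and consider the two-player game with an $(x,y)$-cube described in the context. The optimal (subjective) game state $d_k$ to reduce, given that there are $k\ge 1$ reductions left to play, is $$d_k = \frac{y+x}{2y-xy+x} + \frac{(-x)(1-x)(1-y)}{2(2y-xy+x)}\left(-\frac{y+x}{y(1-x)}\right)^k .$$ Furthermore, reducing at $d_k$ is preferable to not reducing at all.
   Context: The game. Two players A and B play for a stake, initially $1$. The game state is a driftless Brownian motion $p=p(t)$ in $[0,1]$ started at $1/2$; $p$ reaching $1$ means victory for Player A and $p$ reaching $0$ means victory for Player B. The subjective game state of Player A is $p$ and that of Player B is $1-p$; all game states are subjective. A player's subjective state equals the probability that the player would win if there were no doubling; more generally, from a point of an interval the motion hits the right endpoint before the left one with probability equal to the proportion of the interval lying to the left of the point. The $(x,y)$-cube. At any game state in the closed interval $[0,1]$ (including $0$ and $1$, with the final payoff made afterward) a player who has the right to do so may propose a double (play the cube). The first proposal may be made by either player; after a proposal the right to make the next one goes to the opponent, so proposals alternate. When a double is proposed, the opponent either folds, which ends the game with the opponent paying the proposer $x$ times the current stake (since here $x<0$, the folding opponent receives $-x$ times the current stake from the proposer), or accepts, in which case the stake is multiplied by $y$ and play continues. If the state reaches $0$ or $1$ and neither player would double, the game ends, the winner receives the current stake and the loser pays it. ''$k$ reductions left'' means that at most $k$ further proposals can be made in total by the two players. For $(x,y)\in R_-$ the cube is called a reducing cube and proposing a double is called reducing. Both players play to maximize their expected payoff (and this is known to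 both). The optimal game state to reduce is the subjective state at which it is optimal, for a player who has the right to make the next proposal, to reduce. At the optimal reducing state the payoff from reducing, with the current stake normalized to $1$, is $x$; never reducing from state $p$ results in an expected payoff of $2p-1$. ''Reducing at $d_k$ is preferable to not reducing at all'' means that the payoff $x$ of reducing at $d_k$ exceeds $2d_k-1$.
   Formalization: ''Optimal'' is restricted: the state must maximise the payoff of reducing, and only plans to reduce at states with that same payoff are compared; with unrestricted plans the formula fails (k=1: waiting to reduce at 0 beats reducing at d_1 when the opponent may not propose). *)

(* Defs.v *)
From HB Require Import structures.
From mathcomp Require Import all_boot all_order all_algebra.
From mathcomp Require Import all_classical all_reals all_analysis.
Set Implicit Arguments.
Unset Strict Implicit.
Unset Printing Implicit Defensive.
Import Order.TTheory GRing.Theory Num.Theory.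
Import numFieldNormedType.Exports.
Local Open Scope classical_set_scope.
Local Open Scope ring_scope.

(* Driftless Brownian motion with volatility [sigma], started at 0.  The game
   state started at p is p + W t; the game only ever looks at it up to its first
   exit from a subinterval of [0,1]. *)
Definition brownian (disp : measure_display) (T : measurableType disp)
    (R : realType) (P : probability T R) (sigma : R) (W : R -> T -> R) : Prop :=
  [/\ forall t, 0 <= t -> measurable_fun setT (W t),
      forall w, W 0 w = 0,
      forall w, {within `[0, +oo[, continuous (fun t => W t w)},
      forall s t (A : set R), 0 <= s -> s < t -> measurable A ->
        P [set w | A (W t w - W s w)] =
        normal_prob 0 (sigma * Num.sqrt (t - s)) A
    & forall (n : nat) (t : nat -> R) (A : nat -> set R),
        0 <= t 0%N -> (forall i, t i <= t i.+1) ->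
        (forall i, measurable (A i)) ->
        P [set w | forall i, (i < n)%N -> A i (W (t i.+1) w - W (t i) w)] =
        (\prod_(i < n) P [set w | A i (W (t i.+1) w - W (t i) w)%R])%E].

Definition hits_first (T : Type) (R : realType) (W : R -> T -> R)
    (p target other : R) : set T :=
  [set w | exists t, [/\ 0 <= t, p + W t w = target &
                         forall s, 0 <= s <= t -> p + W s w <> other]].

Definition exit_law (disp : measure_display) (T : measurableType disp)
    (R : realType) (P : probability T R) (W : R -> T -> R) : Prop :=
  forall a b p : R, a < b -> a <= p <= b ->
    P (hits_first W p b a) = ((p - a) / (b - a))%:E /\
    P (hits_first W p a b) = ((b - p) / (b - a))%:E.

(* Expected payoff, from state p in [a,b], of receiving u if b is hit first and
   v if a is hit first. *)
Definition exit_payoff (disp : measure_display) (T : measurableType disp)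
    (R : realType) (P : probability T R) (W : R -> T -> R)
    (a b p u v : R) : R :=
  fine (P (hits_first W p b a)) * u + fine (P (hits_first W p a b)) * v.

Definition no_reduction (disp : measure_display) (T : measurableType disp)
    (R : realType) (P : probability T R) (W : R -> T -> R) (p : R) : R :=
  exit_payoff P W 0 1 p 1 (-1).

Definition Rminus (R : realType) : set (R * R) :=
  [set z | 0 < - z.1 < z.2 /\ 0 < z.2 < 1].

(* All states are subjective, the current stake is 1, and every value is the
   expected payoff of the player named.  Since the law of W is symmetric and the
   game treats both players alike, one set of functions serves for both. *)

(* Payoff of the proposer who reduces at state s, where [h] is the value, as a
   function of his own state and at stake 1, for the opponent once he has
   accepted and holds the right to propose.  The opponent picks the better of
   folding (which pays him -x) and accepting (stake y). *)
Definition propose (R : realType) (x y : R) (h : R -> R) (s : R) : R :=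
  - Num.max (- x) (y * h (1 - s)).

(* Value at state p of the only player entitled to make the next proposal, who
   reduces as soon as his state is at most d; [g] is the payoff of reducing.
   If his state reaches 1 before d he wins the stake. *)
Definition plan (disp : measure_display) (T : measurableType disp)
    (R : realType) (P : probability T R) (W : R -> T -> R)
    (g : R -> R) (d p : R) : R :=
  if p <= d then g p else exit_payoff P W d 1 p 1 (g d).

(* Same when both players are entitled to propose, as before the first
   proposal, and the opponent reduces once his own state is at most e, i.e.
   once p is at least 1 - e. *)
Definition plan_shared (disp : measure_display) (T : measurableType disp)
    (R : realType) (P : probability T R) (W : R -> T -> R)
    (g : R -> R) (e d p : R) : R :=
  if p <= d then g p else exit_payoff P W d (1 - e) p (- g e) (g d).

(* [delta k] is the state at which a player entitled to propose reduces when k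
   reductions are left ([delta 0] is irrelevant). *)
Fixpoint hold_value (disp : measure_display) (T : measurableType disp)
    (R : realType) (P : probability T R) (W : R -> T -> R) (x y : R)
    (delta : nat -> R) (k : nat) : R -> R :=
  match k with
  | 0%N => no_reduction P W
  | j.+1 => plan P W (propose x y (hold_value P W x y delta j)) (delta j.+1)
  end.

(* Payoff of reducing at state s when k >= 1 reductions are left, both players
   following delta after an acceptance. *)
Definition reduce_payoff (disp : measure_display) (T : measurableType disp)
    (R : realType) (P : probability T R) (W : R -> T -> R) (x y : R)
    (delta : nat -> R) (k : nat) (s : R) : R :=
  propose x y (hold_value P W x y delta k.-1) s.

(* [d] is an optimal state to reduce when the payoff of reducing at s is [g s]:
   no state gives a higher payoff of reducing and, among the states that give
   this payoff, planning to reduce at d is best from every current state,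
   whether or not the opponent may also propose.  Plans to reduce at a state
   with a lower payoff of reducing are not compared: if they were, no positive
   state would be optimal against an opponent without the right to propose,
   since for (x,y) in R_- and one reduction left, waiting for 0 to reduce there
   is worth (1 + y) p - y from p, more than x at p = (x + y) / (2 y). *)
Definition optimal_state (disp : measure_display) (T : measurableType disp)
    (R : realType) (P : probability T R) (W : R -> T -> R)
    (g : R -> R) (d : R) : Prop :=
  [/\ 0 <= d <= 1,
      forall s, 0 <= s <= 1 -> g s <= g d,
      forall s p, 0 <= s <= 1 -> g s = g d -> 0 <= p <= 1 ->
        plan P W g s p <= plan P W g d p
    & forall s p, 0 <= s <= 1 -> g s = g d -> 0 <= p < 1 - d ->
        plan_shared P W g d s p <= plan_shared P W g d d p].

Definition optimal_reducing (disp : measure_display) (T : measurableType disp)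
    (R : realType) (P : probability T R) (W : R -> T -> R) (x y : R)
    (delta : nat -> R) : Prop :=
  forall k, (1 <= k)%N ->
    optimal_state P W (reduce_payoff P W x y delta k) (delta k).

(* Main.v *)
Require Import Defs.
From HB Require Import structures.
From mathcomp Require Import all_boot all_order all_algebra.
From mathcomp Require Import all_classical all_reals all_analysis.
From mathcomp Require Import ring lra.
Import Order.TTheory GRing.Theory Num.Theory.
Import numFieldNormedType.Exports.
Local Open Scope classical_set_scope.
Local Open Scope ring_scope.

(** Since x < 0, reducing costs the proposer at least - x: a folding opponent
    receives exactly - x, and the opponent accepts only when that pays him
    more.  So the best payoff of reducing is x, obtained wherever the opponent
    is content to fold.  The opponent folds exactly when his own state is low
    enough, so the proposer gets x on an interval from some m to 1.  Reducing
    at m is the unique optimum: by the exit law, waiting for s gives from p > s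
    the ordinate at p of the segment from (s, x) to (1, 1), or to (1 - m, - x)
    if the opponent may reduce too, and this decreases as s grows
    ([optimal_state_iff]).

    It remains to compute m.  When k reductions are left, the holder of the
    cube has at most x below his own reducing state d_k, and above it the
    affine function joining (d_k, x) to (1, 1).  Without any reduction left he
    has 2 q - 1, which is the same profile for the fictitious state
    d_0 = (1 + x) / 2 ([hold_value_profile]).  The opponent folds when this
    value is at most - x / y, which happens up to his state 1 - r (1 - d_k),
    where r = (y + x) / (y (1 - x)).  Hence d_(k+1) = r (1 - d_k), whose
    solution started at d_0 is the closed formula.

    The payoff 2 d_k - 1 of never reducing is less than x exactly when
    d_k < d_0.  In the closed formula d_k is a fixed point plus a positive
    multiple of (- r)^k with 0 < r < 1, so it is largest at k = 0 only. *)

(** * Payoffs under the exit law *)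

Lemma exit_payoffE {disp : measure_display} {T : measurableType disp}
    {R : realType} (P : probability T R) (W : R -> T -> R) (a b p u v : R) :
  exit_law P W -> a < b -> a <= p <= b ->
  exit_payoff P W a b p u v = v + (u - v) * ((p - a) / (b - a)).
Proof.
move=> ex ab apb; have [hb ha] := ex a b p ab apb.
rewrite /exit_payoff hb ha /=; field.
by rewrite subr_eq0 gt_eqF.
Qed.

Lemma no_reductionE {disp : measure_display} {T : measurableType disp}
    {R : realType} (P : probability T R) (W : R -> T -> R) (p : R) :
  exit_law P W -> 0 <= p <= 1 -> no_reduction P W p = 2 * p - 1.
Proof.
by move=> ex p01; rewrite /no_reduction exit_payoffE //; field.
Qed.

(** This compares the plans to reduce at s and at d when both states give the
    same payoff v: the state is at least as likely to reach b before d as to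
    reach it before s. *)
Lemma le_exit_payoff {disp : measure_display} {T : measurableType disp}
    {R : realType} (P : probability T R) (W : R -> T -> R) (d s b p u v : R) :
  exit_law P W -> v <= u -> d <= s -> s < p -> p <= b ->
  exit_payoff P W s b p u v <= exit_payoff P W d b p u v.
Proof.
move=> ex vu ds sp pb.
rewrite !exit_payoffE //; try lra.
rewrite lerD2l ler_wpM2l ?subr_ge0 //.
rewrite ler_pdivrMr; last lra.
rewrite mulrAC ler_pdivlMr; last lra.
by nra.
Qed.

Lemma ge_exit_payoff {disp : measure_display} {T : measurableType disp}
    {R : realType} (P : probability T R) (W : R -> T -> R) (d b p u v : R) :
  exit_law P W -> v <= u -> d < p -> p <= b ->
  v <= exit_payoff P W d b p u v.
Proof.
move=> ex vu dp pb; rewrite exit_payoffE //; try lra.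
rewrite lerDl mulr_ge0 ?subr_ge0 // divr_ge0 //; lra.
Qed.

(** * The optimal state for a given payoff of reducing *)

(** A state d > m cannot be optimal because, from d itself, waiting for m
    yields more than M: with positive probability the player wins the stake
    1 > M before reaching m, and otherwise he still gets M. *)
Lemma optimal_state_iff {disp : measure_display} {T : measurableType disp}
    {R : realType} (P : probability T R) (W : R -> T -> R)
    (g : R -> R) (m M d : R) :
  exit_law P W -> 0 <= m < 1 -> M <= 0 ->
  (forall s, g s <= M) ->
  (forall s, 0 <= s <= 1 -> (g s == M) = (m <= s)) ->
  optimal_state P W g d <-> d = m.
Proof.
move=> ex m01 M0 gM gE.
have gm : g m = M by apply/eqP; rewrite gE; lra.
split=> [[d01 dmax dplan _]|->].
- have gd : g d = M by apply/le_anti; rewrite gM /= -gm dmax //; lra.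
  have md : m <= d by rewrite -gE // gd.
  apply/le_anti; rewrite md andbT leNgt; apply/negP => mltd.
  have := dplan m d; rewrite gd gm /plan lexx (lt_geF mltd) gd gm.
  have -> : 0 <= m <= 1 by lra.
  move=> /(_ isT erefl d01); apply/negP; rewrite -ltNge.
  rewrite exit_payoffE //; try lra.
  rewrite ltrDl mulr_gt0 ?divr_gt0 //; lra.
- split.
  + lra.
  + by move=> s _; rewrite gm.
  + move=> s p s01 gs p01.
    have ms : m <= s by rewrite -gE // gs gm.
    rewrite /plan gs gm.
    case: (leP p s) => [ps|sp]; case: (leP p m) => [pm|mp] //.
    * by apply: le_trans (gM _) _; apply: ge_exit_payoff => //; lra.
    * lra.
    * by apply: le_exit_payoff => //; lra.
  + move=> s p s01 gs p01.
    have ms : m <= s by rewrite -gE // gs gm.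
    rewrite /plan_shared gs gm.
    case: (leP p s) => [ps|sp]; case: (leP p m) => [pm|mp] //.
    * by apply: le_trans (gM _) _; apply: ge_exit_payoff => //; lra.
    * lra.
    * by apply: le_exit_payoff => //; lra.
Qed.

(** * The recursion for the reducing states *)

Definition reducing_state {R : realType} (x y : R) (k : nat) : R :=
  (y + x) / (2 * y - x * y + x) +
  (- x) * (1 - x) * (1 - y) / (2 * (2 * y - x * y + x)) *
  (- ((y + x) / (y * (1 - x)))) ^+ k.

Lemma reducing_state_denom_gt0 {R : realType} (x y : R) :
  Rminus (x, y) -> 0 < 2 * y - x * y + x.
Proof. by case=> /= xy y01; nra. Qed.

Lemma reducing_ratio_itv {R : realType} (x y : R) :
  Rminus (x, y) -> 0 < (y + x) / (y * (1 - x)) < 1.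
Proof.
case=> /= xy y01.
have h : 0 < y * (1 - x) by nra.
by rewrite divr_gt0 ?ltr_pdivrMr ?mul1r //=; nra.
Qed.

Lemma reducing_state0 {R : realType} (x y : R) :
  Rminus (x, y) -> reducing_state x y 0 = (1 + x) / 2.
Proof.
move=> xy; have D := reducing_state_denom_gt0 _ _ xy.
by rewrite /reducing_state expr0; field; lra.
Qed.

Lemma reducing_stateS {R : realType} (x y : R) (k : nat) :
  Rminus (x, y) ->
  reducing_state x y k.+1 =
  (y + x) / (y * (1 - x)) * (1 - reducing_state x y k).
Proof.
move=> xy; have D := reducing_state_denom_gt0 _ _ xy.
case: xy => /= xy y01.
rewrite /reducing_state exprS; move: (_ ^+ k) => z.
field; apply/and3P; split; lra.
Qed.

Lemma reducing_state_itv {R : realType} (x y : R) (k : nat) :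
  Rminus (x, y) -> 0 < reducing_state x y k < 1.
Proof.
move=> xy; elim: k => [|k IH].
  by rewrite reducing_state0 //; case: xy => /= xy y01; lra.
by rewrite reducing_stateS //; have := reducing_ratio_itv _ _ xy; nra.
Qed.

(** Since 0 < r < 1, the factor (- r)^k of the closed formula is less than its
    value 1 at k = 0. *)
Lemma reducing_state_lt0 {R : realType} (x y : R) (k : nat) :
  Rminus (x, y) -> reducing_state x y k.+1 < (1 + x) / 2.
Proof.
move=> xy; rewrite -(reducing_state0 x y xy) /reducing_state expr0.
have D := reducing_state_denom_gt0 _ _ xy.
have r01 := reducing_ratio_itv _ _ xy.
rewrite ltrD2l ltr_pM2l.
  apply: le_lt_trans (ler_norm _) _.
  rewrite normrX normrN; apply: exprn_ilt1; rewrite ?normr_ge0 //.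
  by rewrite ger0_norm; lra.
case: xy => /= xy y01; rewrite divr_gt0 ?mulr_gt0 //; lra.
Qed.

(** * The value of holding the cube *)

Lemma propose_le {R : realType} (x y : R) (h : R -> R) (s : R) :
  propose x y h s <= x.
Proof. by rewrite /propose lerNl le_max lexx. Qed.

Lemma propose_eq {R : realType} (x y : R) (h : R -> R) (s : R) :
  0 < y -> (propose x y h s == x) = (h (1 - s) <= - x / y).
Proof.
move=> y0; rewrite /propose eqr_oppLR eq_sym eq_le le_max lexx /= ge_max lexx /=.
by rewrite ler_pdivlMr // mulrC.
Qed.

(** An opponent who would hold the cube with value h after accepting folds when
    h is at most - x / y.  As x < 0 < - x / y < 1, this happens everywhere
    below d, and above d until the segment from (d, x) to (1, 1) reaches the
    height - x / y.  This is what makes the reducing states satisfy their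
    recursion. *)
Lemma fold_threshold {R : realType} (x y : R) (h : R -> R) (d q : R) :
  Rminus (x, y) -> d < 1 ->
  (q <= d -> h q <= x) ->
  (d < q -> h q = x + (1 - x) * ((q - d) / (1 - d))) ->
  (h q <= - x / y) = (q <= 1 - (y + x) / (y * (1 - x)) * (1 - d)).
Proof.
move=> xy d1 hlow hhigh; have r01 := reducing_ratio_itv _ _ xy.
case: xy => /= xy y01.
have xy0 : 0 < - x / y by rewrite divr_gt0 //; lra.
have [/[dup] qd /hlow hq|/hhigh hq] := leP q d.
  by apply/idP/idP => _; nra.
(* The right-hand side is where the segment reaches the height - x / y. *)
have -> : 1 - (y + x) / (y * (1 - x)) * (1 - d) =
    d + (1 - d) * ((- x / y - x) / (1 - x)) by field; lra.
rewrite hq -lerBrDl mulrC -ler_pdivlMr; last lra.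
rewrite ler_pdivrMr; last lra.
by rewrite lerBlDl [_ * (1 - d)]mulrC.
Qed.

(** The induction is needed for the left end of the segment: that the holder
    gets exactly x by reducing at d_(k+1) depends on when his opponent folds,
    hence on the profile of the value with one reduction less.  Below the
    reducing state an upper bound is enough to know that the opponent folds. *)
Lemma hold_value_profile {disp : measure_display} {T : measurableType disp}
    {R : realType} (P : probability T R) (W : R -> T -> R) (x y : R)
    (delta : nat -> R) (k : nat) (q : R) :
  exit_law P W -> Rminus (x, y) ->
  (forall j, (0 < j <= k)%N -> delta j = reducing_state x y j) ->
  0 <= q <= 1 ->
  let d := reducing_state x y k in
  (q <= d -> hold_value P W x y delta k q <= x) /\
  (d < q ->
    hold_value P W x y delta k q = x + (1 - x) * ((q - d) / (1 - d))).
Proof.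
move=> ex xy; elim: k q => [|k IH] q dE q01 /=.
  rewrite no_reductionE // reducing_state0 //; case: xy => /= xy y01.
  by split=> qd; [lra | field; lra].
have d01 := reducing_state_itv x y k.+1 xy.
have e01 := reducing_state_itv x y k xy.
rewrite /plan dE ?leqnn //.
split=> qd; first by rewrite qd; apply: propose_le.
rewrite (lt_geF qd).
have -> : propose x y (hold_value P W x y delta k) (reducing_state x y k.+1) = x.
  apply/eqP; rewrite propose_eq; last by case: xy => /= xy y01; lra.
  have [] := IH (1 - reducing_state x y k.+1).
  - by move=> j /andP[j0 jk]; apply: dE; rewrite j0 leqW.
  - by lra.
  move=> low high; rewrite (fold_threshold x y _ (reducing_state x y k)) //.
    by rewrite reducing_stateS.
  by lra.
by rewrite exit_payoffE //; lra.
Qed.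

Lemma reduce_payoff_eq {disp : measure_display} {T : measurableType disp}
    {R : realType} (P : probability T R) (W : R -> T -> R) (x y : R)
    (delta : nat -> R) (k : nat) (s : R) :
  exit_law P W -> Rminus (x, y) ->
  (forall j, (0 < j <= k)%N -> delta j = reducing_state x y j) ->
  0 <= s <= 1 ->
  (reduce_payoff P W x y delta k.+1 s == x) = (reducing_state x y k.+1 <= s).
Proof.
move=> ex xy dE s01; have d01 := reducing_state_itv x y k xy.
rewrite /reduce_payoff propose_eq; last by case: xy => /= xy y01; lra.
have [|low high] := hold_value_profile P W x y delta k (1 - s) ex xy dE.
  by lra.
rewrite (fold_threshold x y _ (reducing_state x y k)) //; last by lra.
by rewrite -reducing_stateS // lerD2l lerN2.
Qed.

Lemma optimal_stateS {disp : measure_display} {T : measurableType disp}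
    {R : realType} (P : probability T R) (W : R -> T -> R) (x y : R)
    (delta : nat -> R) (k : nat) :
  exit_law P W -> Rminus (x, y) ->
  (forall j, (0 < j <= k)%N -> delta j = reducing_state x y j) ->
  optimal_state P W (reduce_payoff P W x y delta k.+1) (delta k.+1) <->
  delta k.+1 = reducing_state x y k.+1.
Proof.
move=> ex xy dE; have d01 := reducing_state_itv x y k.+1 xy.
apply: (optimal_state_iff _ _ _ _ x) => //.
- by lra.
- by case: xy => /= xy y01; lra.
- by move=> s; apply: propose_le.
- by move=> s; apply: reduce_payoff_eq.
Qed.

(** Whether delta is optimal with k + 1 reductions left depends on delta only
    through its values up to k + 1, so uniqueness follows by induction. *)
Lemma optimal_reducing_iff {disp : measure_display} {T : measurableType disp}
    {R : realType} (P : probability T R) (W : R -> T -> R) (x y : R)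
    (delta : nat -> R) :
  exit_law P W -> Rminus (x, y) ->
  optimal_reducing P W x y delta <->
  forall k, (0 < k)%N -> delta k = reducing_state x y k.
Proof.
move=> ex xy; split=> H.
- elim/ltn_ind=> -[//|k] IH _.
  apply/(optimal_stateS _ _ _ _ _ _ ex xy); last exact: H.
  by move=> j /andP[j0 jk]; apply: IH.
- case=> // k _; apply/(optimal_stateS _ _ _ _ _ _ ex xy); last exact: H.
  by move=> j /andP[j0 _]; apply: H.
Qed.

Theorem theorem1p5 (disp : measure_display) (T : measurableType disp)
    (R : realType) (P : probability T R) (sigma : R) (W : R -> T -> R)
    (x y : R) :
  0 < sigma -> brownian P sigma W -> exit_law P W -> Rminus (x, y) ->
  (forall delta : nat -> R,
     optimal_reducing P W x y delta <->
     (forall k : nat, (1 <= k)%N ->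
        delta k = (y + x) / (2 * y - x * y + x) +
                  (- x) * (1 - x) * (1 - y) / (2 * (2 * y - x * y + x)) *
                  (- ((y + x) / (y * (1 - x)))) ^+ k)) /\
  (forall delta : nat -> R, optimal_reducing P W x y delta ->
     forall k : nat, (1 <= k)%N ->
       [/\ reduce_payoff P W x y delta k (delta k) = x,
           no_reduction P W (delta k) = 2 * delta k - 1
         & no_reduction P W (delta k) <
           reduce_payoff P W x y delta k (delta k)]).
Proof.
move=> _ _ ex xy; split=> delta; first exact: optimal_reducing_iff.
move=> /(optimal_reducing_iff _ _ _ _ _ ex xy) dE [//|k] _.
have d01 := reducing_state_itv x y k.+1 xy.
have payoff : reduce_payoff P W x y delta k.+1 (delta k.+1) = x.
  apply/eqP; rewrite reduce_payoff_eq ?dE //; last by lra.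
  by move=> j /andP[j0 _]; apply: dE.
have never : no_reduction P W (delta k.+1) = 2 * delta k.+1 - 1.
  by apply: no_reductionE => //; rewrite dE //; lra.
split=> //; rewrite payoff never dE //.
by have := reducing_state_lt0 _ _ k xy; lra.
Qed.
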